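(* Let $f \colon \mathbb{R}^n \to \mathbb{R}$, $g \colon \mathbb{R}^n \to \mathbb{R}^m$, $h \colon \mathbb{R}^n \to \mathbb{R}^p$ be continuously differentiable, let $\rho > 0$, and let $p^\rho(y) = \sum_{i=1}^n p_i^\rho(y_i)$ with each $p_i^\rho$ satisfying (P.1)--(P.3) stated in the context. Let $\delta = 0$, and let $\{(x^k,y^k)\}$ be an infinite sequence generated by the Exact Penalty Algorithm described in the context such that $x^{k+1} \to_K x^*$ along some subsequence (infinite index set) $K \subseteq \mathbb{N}$. Then there is an infinite subset $K' \subseteq K$ and a point $y^* \in \mathbb{R}^n$ such that $y^{k+1} \to_{K'} y^*$ and $x_i^* y_i^* = 0$ holds for all $i = 1,\dots,n$.
   Context: Notation: $e_i$ is the $i$-th unit vector; $\mathbb{R}^n_+$ is the set of vectors with nonnegative entries; $L^{SP}(x,\lambda,\mu) := f(x) + \lambda^T g(x) + \mu^T h(x)$; $\to_K$ denotes convergence along indices $k \in K$, $k \to \infty$. Conditions on $p_i^\rho \colon \mathbb{R} \to \mathbb{R}$: (P.1) $p_i^\rho$ is convex and attains a unique minimum at some point $s_i^\rho > 0$; (P.2) $p_i^\rho(0) - p_i^\rho(s_i^\rho) = \rho$; (P.3) $p_i^\rho$ is continuously differentiable. Exact Penalty Algorithm: Step 1. Choose a nonnegative sequence $\varepsilon_k \searrow 0$ and parameters $\alpha_0 > 0$, $\beta > 1$, $\delta \ge 0$. Step 2. For $k = 0,1,2,\dots$ compute $(x^{k+1}, y^{k+1}, \lambda^{k+1}, \mu^{k+1},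 \nu_x^{k+1}, \nu_y^{k+1}) \in \mathbb{R}^n_+ \times \mathbb{R}^n_+ \times \mathbb{R}^m_+ \times \mathbb{R}^p \times \mathbb{R}^n_+ \times \mathbb{R}^n_+$ such that (i) $\|\nabla_x L^{SP}(x^{k+1},\lambda^{k+1},\mu^{k+1}) - \sum_{i=1}^n (\nu_x^{k+1})_i e_i + \alpha_k y^{k+1}\| \le \varepsilon_k$, (ii) $\|\nabla p^\rho(y^{k+1}) - \sum_{i=1}^n (\nu_y^{k+1})_i e_i + \alpha_k x^{k+1}\| \le \varepsilon_k$, (iii) $|\min\{-g_i(x^{k+1}), \lambda_i^{k+1}\}| \le \varepsilon_k$, $i=1,\dots,m$, (iv) $\|h(x^{k+1})\| \le \varepsilon_k$, (v) $\min\{x_i^{k+1}, (\nu_x^{k+1})_i\} \le \varepsilon_k$, $i=1,\dots,n$, (vi) $\min\{y_i^{k+1}, (\nu_y^{k+1})_i\} \le \varepsilon_k$, $i=1,\dots,n$. Step 3. If $\varepsilon_k \le \delta$ and $\sum_{i=1}^n x_i^{k+1} y_i^{k+1} \le \delta$, STOP. Otherwise set $\alpha_{k+1} = \alpha_k \beta$ and go to Step 2. *)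

(* Defs.v *)
From HB Require Import structures.
From mathcomp Require Export all_boot all_order all_algebra.
From mathcomp Require Export all_classical all_reals all_analysis.
Export Order.TTheory GRing.Theory Num.Theory.
Export numFieldNormedType.Exports.

#[export] Set Implicit Arguments.
#[export] Unset Strict Implicit.
#[export] Unset Printing Implicit Defensive.

#[global] Open Scope classical_set_scope.
#[global] Open Scope ring_scope.

(* The library norm on ['rV[R]_n] is the sup norm. *)
Definition enorm {R : realType} {n : nat} (v : 'rV[R]_n) : R :=
  Num.sqrt (\sum_i v 0 i ^+ 2).

Definition nonneg_vec {R : realType} {n : nat} (v : 'rV[R]_n) : Prop :=
  forall i, 0 <= v 0 i.

Definition evec {R : realType} {n : nat} (i : 'I_n) : 'rV[R]_n := delta_mx 0 i.

(* ['D_v F x] is a bare limit with a junk value when it does not exist; it is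
   only used below for differentiable [F]. *)
Definition grad {R : realType} {n : nat} (F : 'rV[R]_n -> R) (x : 'rV[R]_n) :
  'rV[R]_n := \row_i 'D_(evec i) F x.

Definition cont_diff {R : realType} {n : nat} {W : normedModType R}
    (F : 'rV[R]_n -> W) : Prop :=
  (forall x, differentiable F x) /\ (forall i, continuous ('D_(evec i) F)).

Definition LSP {R : realType} {n m p : nat} (f : 'rV[R]_n -> R)
    (g : 'rV[R]_n -> 'rV[R]_m) (h : 'rV[R]_n -> 'rV[R]_p)
    (x : 'rV[R]_n) (lam : 'rV[R]_m) (mu : 'rV[R]_p) : R :=
  f x + \sum_i lam 0 i * g x 0 i + \sum_j mu 0 j * h x 0 j.

Definition cond_P1 {R : realType} (q : R -> R) (s : R) : Prop :=
  [/\ convex_function [set: R^o] q, 0 < s & forall t, t != s -> q s < q t].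

Definition cond_P2 {R : realType} (rho : R) (q : R -> R) (s : R) : Prop :=
  q 0 - q s = rho.

Definition cond_P3 {R : realType} (q : R -> R) : Prop :=
  (forall t, derivable q t 1) /\ continuous (derive1 q).

Definition sep_penalty {R : realType} {n : nat} (q : 'I_n -> R -> R)
    (y : 'rV[R]_n) : R := \sum_i q i (y 0 i).

(* An infinite run, i.e. one where the test of Step 3 always fails.  The
   iterates produced at iteration [k] have index [k.+1]; their values at index
   [0] are irrelevant. *)
Record EPA_infinite_run {R : realType} {n m p : nat}
    (f : 'rV[R]_n -> R) (g : 'rV[R]_n -> 'rV[R]_m) (h : 'rV[R]_n -> 'rV[R]_p)
    (prho : 'rV[R]_n -> R) (delta : R) (eps alpha : nat -> R) (beta : R)
    (x y : nat -> 'rV[R]_n) (lam : nat -> 'rV[R]_m) (mu : nat -> 'rV[R]_p)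
    (nux nuy : nat -> 'rV[R]_n) : Prop := {
  epa_eps_ge0 : forall k, 0 <= eps k;
  epa_eps_nonincr : nonincreasing_seq eps;
  epa_eps_cvg0 : eps @ \oo --> (0 : R);
  epa_alpha0_gt0 : 0 < alpha 0%N;
  epa_beta_gt1 : 1 < beta;
  epa_delta_ge0 : 0 <= delta;

  epa_x_ge0 : forall k, nonneg_vec (x k.+1);
  epa_y_ge0 : forall k, nonneg_vec (y k.+1);
  epa_lam_ge0 : forall k, nonneg_vec (lam k.+1);
  epa_nux_ge0 : forall k, nonneg_vec (nux k.+1);
  epa_nuy_ge0 : forall k, nonneg_vec (nuy k.+1);
  epa_i : forall k,
    enorm (grad (fun z => LSP f g h z (lam k.+1) (mu k.+1)) (x k.+1)
           - \sum_i nux k.+1 0 i *: evec i + alpha k *: y k.+1) <= eps k;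
  epa_ii : forall k,
    enorm (grad prho (y k.+1)
           - \sum_i nuy k.+1 0 i *: evec i + alpha k *: x k.+1) <= eps k;
  epa_iii : forall k i,
    `| Num.min (- g (x k.+1) 0 i) (lam k.+1 0 i) | <= eps k;
  epa_iv : forall k, enorm (h (x k.+1)) <= eps k;
  epa_v : forall k i, Num.min (x k.+1 0 i) (nux k.+1 0 i) <= eps k;
  epa_vi : forall k i, Num.min (y k.+1 0 i) (nuy k.+1 0 i) <= eps k;

  epa_nostop : forall k,
    ~ (eps k <= delta /\ \sum_i x k.+1 0 i * y k.+1 0 i <= delta);
  epa_alphaS : forall k, alpha k.+1 = alpha k * beta }.

(* Main.v *)
Require Import Defs.
From mathcomp Require Import ring lra.

(** Fix a coordinate [i] and write [q], [x_k], [y_k], [nu_k], [a_k] for [prho i],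
    the [i]-th entries of the iterates and multiplier, and the penalty parameter.
    The algorithm tests approximate stationarity in [y], so
    [`|q'(y_k) - nu_k + a_k * x_k| <= eps_k], and it tests
    [min(y_k, nu_k) <= eps_k].  As soon as [y_k] exceeds [eps_k], the multiplier
    is at most [eps_k], and what remains is the slope bound
    [q'(y_k) + a_k * x_k <= 2 * eps_k] ([approx_stationary_slope_le]).
    Boundedness of [y_k] and complementarity of the limits both follow from this
    bound, because [q'] is nondecreasing ([convex_derive1_le]).

    Boundedness of [y_k]: to the right of the minimizer [s] the slope of [q] is
    positive, and beyond [s + 1] it is at least [q'(s + 1) > 0].  Since
    [a_k * x_k >= 0] and [eps_k] tends to [0], the slope bound eventually forbids
    [y_k > s + 1] ([slope_bound_eventually_le]).  Hence the vectors with entries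
    [y_k] end up in a compact box and, along [K], have a cluster point, which is the limit
    along some infinite [K'] included in [K] ([cluster_within_subseq]).

    Complementarity of the limits: if both limits were positive, then along [K']
    the product [a_k * x_k] would tend to [+oo], as [a_k] grows geometrically,
    while [q'(y_k) >= q'(0)] stays bounded below; this again contradicts the
    slope bound ([slope_bound_complementary]). *)

(** The graph of [q] lies above its tangents: by convexity every difference
    quotient of [q] from [a] towards [b] with step at most [1] is at most
    [q b - q a], and the directional derivative is the limit of these
    quotients. *)
Lemma convex_tangent_le (R : realType) (q : R -> R) (a b : R) :
  convex_function [set: R^o] q -> derivable q a 1 ->
  q a + derive1 q a * (b - a) <= q b.
Proof.
move=> cvxq dq.
have dfq : differentiable q a by apply/derivable1_diffP.
have Dq : 'D_(b - a) q a = derive1 q a * (b - a).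
  by rewrite deriveE// derive1E' // -[in LHS](mulr1 (b - a)) linearZ/= mulrC.
rewrite -Dq -lerBrDl.
have : derivable q a (b - a) by apply: diff_derivable.
move=> /cvg_dnbhs_at_right /cvgr_to_le; apply; near=> t.
have t0 : 0 < t by near: t; exact: nbhs_right_gt.
have t1 : t <= 1 by near: t; exact: nbhs_right_ltW.
(* [t] has to be packed as a point of the unit interval to serve as the weight of
   [b] in the convex combination. *)
have t01 : Itv.spec (@Itv.num_sem R) (Itv.Real `[0%Z, 1%Z]) t.
  by rewrite /= /Itv.num_sem/= num_real in_itv/= (ltW t0).
have := cvxq (Itv.mk t01) b a; rewrite !inE => /(_ I I).
rewrite !convRE /= /unstable.onem => cvx.
rewrite /= -[_ *: _]/(t^-1 * _) ler_pdivrMl// -[t *: _]/(t * _).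
have -> : t * (b - a) + a = t * b + (1 - t) * a by ring.
lra.
Unshelve. all: end_near. Qed.

(** Add the tangent inequality from [a] to [b] to the one from [b] to [a]. *)
Lemma convex_derive1_le (R : realType) (q : R -> R) (a b : R) :
  convex_function [set: R^o] q -> (forall t, derivable q t 1) ->
  a <= b -> derive1 q a <= derive1 q b.
Proof.
move=> cvxq dq; rewrite le_eqVlt => /predU1P[->//|ab].
have h1 := convex_tangent_le b cvxq (dq a).
have h2 := convex_tangent_le a cvxq (dq b).
rewrite -(ler_pM2r (_ : 0 < b - a)) ?subr_gt0//; lra.
Qed.

(** The tangent at [t] passes below the graph at [s], hence strictly below the
    level [q t]. *)
Lemma convex_derive1_gt0 (R : realType) (q : R -> R) (s t : R) :
  convex_function [set: R^o] q -> derivable q t 1 -> s < t -> q s < q t ->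
  0 < derive1 q t.
Proof.
move=> cvxq dq st qst; have h := convex_tangent_le s cvxq dq.
have ts : 0 < t - s by rewrite subr_gt0.
by rewrite -(pmulr_lgt0 _ ts); lra.
Qed.

(** A step along [evec i] changes the [i]-th summand only, so the difference
    quotients whose limits define the two sides are the same functions. *)
Lemma grad_sep_penalty (R : realType) n (q : 'I_n -> R -> R) (y : 'rV[R]_n) i :
  grad (sep_penalty q) y 0 i = derive1 (q i) (y 0 i).
Proof.
rewrite mxE derive1E /derive; set F := (X in lim (X @ _)).
suff <- : F = (fun h => h^-1 *: ((q i \o shift (y 0 i)) (h *: 1) - q i (y 0 i))).
  by [].
apply/funext => h; rewrite /F /=; congr (_ *: _).
rewrite /sep_penalty -sumrB (bigD1 i)//= big1 => [|j /negPf ji].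
  by rewrite addr0 !mxE !eqxx.
by rewrite !mxE eqxx ji mulr0 add0r subrr.
Qed.

Lemma coord_le_enorm (R : realType) n (v : 'rV[R]_n) i : `|v 0 i| <= enorm v.
Proof.
rewrite -sqrtr_sqr ler_wsqrtr// (bigD1 i)//= lerDl.
by apply: sumr_ge0 => j _; exact: sqr_ge0.
Qed.

Lemma infinite_nat_unbounded (A : set nat) :
  infinite_set A <-> forall N, exists2 k, A k & (N <= k)%N.
Proof.
split=> [Ainf N|Aunb Afin].
  apply: contrapT => noA; apply: Ainf; apply: sub_finite_set (finite_II N).
  by move=> k Ak /=; rewrite ltnNge; apply/negP => Nk; apply: noA; exists k.
apply: infinite_nat.
apply: (@sub_finite_set _ _ (\bigcup_(k in A) `I_k.+1)).
  by move=> N _; have [k Ak Nk] := Aunb N; exists k.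
by apply: bigcup_finite => // k _; exact: finite_II.
Qed.

(** Makes limits and cluster points along an infinite index set available through
    the general theory of proper filters. *)
Lemma within_infinite_proper (A : set nat) :
  infinite_set A -> ProperFilter (within A \oo).
Proof.
move=> /infinite_nat_unbounded Aunb; split; last exact: within_filter.
by move=> [N _ NA]; have [k Ak Nk] := Aunb N; exact: (NA k).
Qed.

(** A cluster point of [u] along [A] is within [1 / (j + 1)] of [u k] for some
    [k >= j] in [A].  Choosing such a [phi j] for each [j], the set [range phi]
    is the required [B]: it is unbounded, and all but finitely many of its
    elements are of the form [phi j] with [j] large. *)
Lemma cluster_within_subseq (R : realType) (V : normedModType R)
    (u : nat -> V) (A : set nat) (l : V) :
  cluster (u @ within A \oo) l ->
  exists B : set nat,
    [/\ B `<=` A, infinite_set B & u @ within B \oo --> l].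
Proof.
move=> clul.
have close j : exists k, [/\ A k, (j <= k)%N & `|l - u k| < j.+1%:R^-1].
  have Aj : (u @ within A \oo) (u @` (A `&` [set k | (j <= k)%N])).
    by exists j => // k /= jk Ak; exists k.
  have [|_ [[k [Ak jk] <-] lk]] := clul _ (ball l j.+1%:R^-1) Aj.
    by apply: nbhsx_ballx; rewrite invr_gt0 ltr0n.
  by exists k; split => //; move: lk; rewrite -ball_normE.
have [phi /all_and3 [phiA phi_ge phil]] := choice close.
exists (range phi); split.
- by move=> _ [j _ <-].
- apply/infinite_nat_unbounded => N.
  by exists (phi N).
apply/cvgrPdist_lt => e e0.
near \oo => N.
(* [phi] need not be monotone: an index above all of [phi 0], .., [phi N.-1] can
   only be reached as [phi j] with [N <= j]. *)
exists (\max_(j < N) phi j).+1 => //= k Mk [j _ jk].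
have Nj : (N <= j)%N.
  rewrite leqNgt; apply/negP => jN; move: Mk; rewrite /= -jk ltnNge.
  by rewrite (leq_bigmax (Ordinal jN)).
rewrite -jk (lt_trans (phil j))// invf_plt ?posrE ?ltr0n//.
rewrite (@lt_le_trans _ _ N%:R)//; last by rewrite ler_nat leqW.
near: N; exact: nbhs_infty_gtr.
Unshelve. all: end_near. Qed.

(** The inverses form a null geometric sequence of ratio [b^-1 < 1]. *)
Lemma geometric_pinfty (R : realType) (a b : R) : 0 < a -> 1 < b ->
  a * b ^+ k @[k --> \oo] --> +oo.
Proof.
move=> a0 b1; apply/cvgryPgt => c.
have b0 : 0 < b by rewrite (lt_trans ltr01).
have binv1 : `|b^-1| < 1 by rewrite gtr0_norm ?invr_gt0// invf_lt1.
have c0 : 0 < `|c| + 1 by rewrite ltr_wpDl.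
have /cvgrPdist_lt/(_ (`|c| + 1)^-1) := @cvg_geometric R a^-1 b^-1 binv1.
rewrite invr_gt0 => /(_ c0); apply: filterS => k.
rewrite sub0r normrN /= exprVn -invfM gtr0_norm ?invr_gt0 ?mulr_gt0 ?exprn_gt0//.
rewrite ltf_pV2 ?posrE ?mulr_gt0 ?exprn_gt0//; apply: lt_trans.
by rewrite (le_lt_trans (ler_norm c))// ltrDl.
Qed.

(** When [y 0 i] exceeds the tolerance [e], the complementarity test can only be
    met by the multiplier, which is therefore at most [e]; it can then be moved
    into the error of the stationarity test, doubling that error. *)
Lemma approx_stationary_slope_le (R : realType) n (q : 'I_n -> R -> R)
    (x y nu : 'rV[R]_n) (a e : R) (i : 'I_n) :
  enorm (grad (sep_penalty q) y - \sum_j nu 0 j *: evec j + a *: x) <= e ->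
  Num.min (y 0 i) (nu 0 i) <= e -> e < y 0 i ->
  derive1 (q i) (y 0 i) + a * x 0 i <= 2 * e.
Proof.
move=> stat cmp ey.
have nue : nu 0 i <= e by move: cmp; rewrite ge_min leNgt ey.
have := le_trans (le_trans (ler_norm _) (coord_le_enorm _ i)) stat.
rewrite [\sum_j _](_ : _ = nu); last exact/esym/row_sum_delta.
by rewrite 2!mxE grad_sep_penalty !mxE; lra.
Qed.

Lemma compact_box (R : realType) n (b : 'I_n -> R) :
  compact [set v : 'rV[R]_n | forall i, 0 <= v 0 i <= b i].
Proof.
exact: (rV_compact (fun i => @segment_compact R 0 (b i))).
Qed.

(** Beyond [s + 1] the slope of [q] is at least [q'(s + 1) > 0], which exceeds
    [2 * e k] once [e k] is small. *)
Lemma slope_bound_eventually_le (R : realType) (T : Type) (F : set_system T)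
    {FF : Filter F} (q : R -> R) (s : R) (e w eta : T -> R) :
  convex_function [set: R^o] q -> (forall t, derivable q t 1) ->
  0 < s -> (forall t, t != s -> q s < q t) ->
  e @ F --> (0 : R) -> (forall k, 0 <= w k) ->
  (forall k, e k < eta k -> derive1 q (eta k) + w k <= 2 * e k) ->
  \forall k \near F, eta k <= s + 1.
Proof.
move=> cvxq dq s0 smin e0 w0 slope.
have c0 : 0 < derive1 q (s + 1).
  apply: (@convex_derive1_gt0 _ _ s) => //; first by rewrite ltrDl.
  by apply: smin; rewrite gt_eqF// ltrDl.
near=> k; rewrite leNgt; apply/negP => seta.
have ec : e k < derive1 q (s + 1) / 2.
  by near: k; apply: cvgr_lt e0 _ _; rewrite divr_gt0.
have es : e k < s + 1 by near: k; apply: cvgr_lt e0 _ _; rewrite addr_gt0.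
have := slope k (lt_trans es seta).
have := convex_derive1_le cvxq dq (ltW seta).
have := w0 k; lra.
Unshelve. all: end_near. Qed.

(** If both limits were positive, then eventually [xi k > x / 2] and
    [eta k > y / 2 > e k]; the slope bound together with [q'(eta k) >= q'(0)]
    would keep [a k * (x / 2)] below a constant. *)
Lemma slope_bound_complementary (R : realType) (T : Type) (F : set_system T)
    {FF : ProperFilter F} (q : R -> R) (e a xi eta : T -> R) (x y : R) :
  convex_function [set: R^o] q -> (forall t, derivable q t 1) ->
  e @ F --> (0 : R) -> a @ F --> +oo ->
  xi @ F --> x -> eta @ F --> y ->
  (forall k, 0 <= xi k) -> (forall k, 0 <= eta k) ->
  (forall k, e k < eta k -> derive1 q (eta k) + a k * xi k <= 2 * e k) ->
  x * y = 0.
Proof.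
move=> cvxq dq e0 aoo xix etay xi0 eta0 slope; apply/eqP; apply: contrapT.
move/negP; rewrite mulf_eq0 negb_or => /andP[x0 y0].
have {}x0 : 0 < x.
  by rewrite lt_neqAle eq_sym x0; apply: (cvgr_to_ge xix); exact: nearW.
have {}y0 : 0 < y.
  by rewrite lt_neqAle eq_sym y0; apply: (cvgr_to_ge etay); exact: nearW.
have x20 : 0 < x / 2 by rewrite divr_gt0.
have y20 : 0 < y / 2 by rewrite divr_gt0.
(* The value that the slope bound allows for [a k] when [e k < y / 2],
   [eta k >= 0] and [xi k > x / 2]. *)
pose c := (2 * (y / 2) - derive1 q 0) / (x / 2).
near F => k.
have ey : e k < y / 2 by near: k; exact: cvgr_lt e0 _ _.
have eta_k : y / 2 < eta k by near: k; apply: cvgr_gt etay _ _; lra.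
have xi_k : x / 2 < xi k by near: k; apply: cvgr_gt xix _ _; lra.
have a_k0 : 0 < a k by near: k; exact: cvgry_gt.
have a_k : c < a k by near: k; exact: cvgry_gt.
have := slope k (lt_trans ey eta_k).
have := convex_derive1_le cvxq dq (eta0 k).
have : a k * (x / 2) < a k * xi k by rewrite ltr_pM2l.
have : c * (x / 2) < a k * (x / 2) by rewrite ltr_pM2r.
rewrite /c divfK ?gt_eqF//; lra.
Unshelve. all: end_near. Qed.

Theorem theorem6p7 (R : realType) (n m p : nat)
    (f : 'rV[R]_n -> R) (g : 'rV[R]_n -> 'rV[R]_m) (h : 'rV[R]_n -> 'rV[R]_p)
    (f_C1 : cont_diff f) (g_C1 : cont_diff g) (h_C1 : cont_diff h)
    (rho : R) (rho_gt0 : 0 < rho)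
    (prho : 'I_n -> R -> R) (s : 'I_n -> R)
    (P1 : forall i, cond_P1 (prho i) (s i))
    (P2 : forall i, cond_P2 rho (prho i) (s i))
    (P3 : forall i, cond_P3 (prho i))
    (delta : R) (delta0 : delta = 0)
    (eps alpha : nat -> R) (beta : R)
    (x y : nat -> 'rV[R]_n) (lam : nat -> 'rV[R]_m) (mu : nat -> 'rV[R]_p)
    (nux nuy : nat -> 'rV[R]_n)
    (run : EPA_infinite_run f g h (sep_penalty prho) delta eps alpha beta
             x y lam mu nux nuy)
    (K : set nat) (K_inf : infinite_set K) (xs : 'rV[R]_n)
    (x_cvg : (fun k => x k.+1) @ within K \oo --> xs) :
  exists (K' : set nat) (ys : 'rV[R]_n),
    [/\ K' `<=` K, infinite_set K',
        (fun k => y k.+1) @ within K' \oo --> ys &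
        forall i, xs 0 i * ys 0 i = 0].
Proof.
have alphaE : alpha = fun k => alpha 0%N * beta ^+ k.
  apply/funext; elim=> [|k IHk]; first by rewrite expr0 mulr1.
  by rewrite (epa_alphaS run) IHk exprSr mulrA.
have alpha_oo : alpha @ \oo --> +oo.
  rewrite alphaE.
  exact: geometric_pinfty (epa_alpha0_gt0 run) (epa_beta_gt1 run).
have alpha_gt0 k : 0 < alpha k.
  rewrite alphaE mulr_gt0 ?exprn_gt0 ?(epa_alpha0_gt0 run)//.
  exact: lt_trans ltr01 (epa_beta_gt1 run).
have slope i k : eps k < y k.+1 0 i ->
    derive1 (prho i) (y k.+1 0 i) + alpha k * x k.+1 0 i <= 2 * eps k.
  exact: approx_stationary_slope_le (epa_ii run k) (epa_vi run k i).
have y_box : \forall k \near \oo, forall i, 0 <= y k.+1 0 i <= s i + 1.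
  apply: (@filter_forall _ _ (fun i k => 0 <= y k.+1 0 i <= s i + 1)) => i.
  have [cvxq s0 smin] := P1 i.
  have ax_ge0 k : 0 <= alpha k * x k.+1 0 i.
    by rewrite mulr_ge0 ?(ltW (alpha_gt0 k))// (epa_x_ge0 run).
  have y_le : \forall k \near \oo, y k.+1 0 i <= s i + 1.
    exact: slope_bound_eventually_le cvxq (P3 i).1 s0 smin (epa_eps_cvg0 run)
      ax_ge0 (slope i).
  by apply: filterS y_le => k ->; rewrite (epa_y_ge0 run).
have KF := within_infinite_proper K_inf.
have [|ys [_ /cluster_within_subseq[K' [K'K K'inf y_cvg]]]] :=
  compact_box (b := fun i => s i + 1) (F := (fun k => y k.+1) @ within K \oo) _.
  exact: cvg_within y_box.
exists K', ys; split=> // i.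
have K'F := within_infinite_proper K'inf.
have coordE (u : nat -> 'rV[R]_n) (l : 'rV[R]_n) : u @ within K' \oo --> l ->
    u k 0 i @[k --> within K' \oo] --> l 0 i.
  by move=> ul; exact: (cvg_comp _ _ ul (@coord_continuous R 1 n 0 i l)).
apply: (@slope_bound_complementary R nat (within K' \oo) K'F (prho i) eps alpha
    (fun k => x k.+1 0 i) (fun k => y k.+1 0 i)).
- by have [] := P1 i.
- by have [] := P3 i.
- exact: cvg_trans (cvg_app _ (cvg_within _)) (epa_eps_cvg0 run).
- exact: cvg_trans (cvg_app _ (cvg_within _)) alpha_oo.
- apply: (coordE (fun k => x k.+1)); apply: cvg_trans x_cvg; apply: cvg_app.
  exact: within_subset.
- exact: (coordE (fun k => y k.+1)).
- by move=> k; exact: (epa_x_ge0 run).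
- by move=> k; exact: (epa_y_ge0 run).
- exact: slope.
Qed.
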